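(* Let $M\in\mathbb{R}^{m\times n}$, let $r$ be a positive integer with $r<\min(m,n)$, let $A\in\mathbb{R}^{m\times r}$ have orthonormal columns, let $$M=U^{(r)}\Sigma^{(r)}(V^{(r)})^T+U_\perp^{(r)}\Sigma_\perp^{(r)}(V_\perp^{(r)})^T$$ be the SVD of $M$, where $\Sigma^{(r)}=\operatorname{diag}(\sigma_1(M),\dots,\sigma_r(M))$, and let $B:=A^+M$. Assume that $$\sigma_{r+1}(M)<\sigma_r(M)\quad\text{and}\quad\operatorname{Dist}(A,U^{(r)})<\sqrt{1-\frac{\sigma_{r+1}^2(M)}{\sigma_r^2(M)}}.$$ Then $$\operatorname{Dist}(B^T,V^{(r)})<c\cdot\operatorname{Dist}(A,U^{(r)})\quad\text{for}\quad c:=\frac{1}{\sqrt{1-\operatorname{Dist}(A,U^{(r)})^2}}\cdot\frac{\sigma_{r+1}(M)}{\sigma_r(M)}.$$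
   Context: All matrices are real. $\sigma_j(M)$ is the $j$-th largest singular value of $M$; $\|\cdot\|$ is the spectral norm; $W^+$ is the Moore–Penrose pseudoinverse of a matrix $W$; $\operatorname{range}(W)$ is its column span. In the SVD, $U^{(r)}\in\mathbb{R}^{m\times r}$ and $V^{(r)}\in\mathbb{R}^{n\times r}$ contain the top $r$ left and right singular vectors of $M$, and $U_\perp^{(r)},\Sigma_\perp^{(r)},V_\perp^{(r)}$ contain the remaining left singular vectors, singular values, and right singular vectors, respectively. Principal Angle Distance. For two subspaces $E_1,E_2$ of the same dimension in $\mathbb{R}^k$, let $G,H$ be matrices with orthonormal columns spanning $E_1,E_2$, and $G_\perp,H_\perp$ matrices with orthonormal columns spanning their orthogonal complements; then $\operatorname{Dist}(E_1,E_2):=\|G_\perp^TH\|=\|H_\perp^TG\|$. If the dimensions differ, $\operatorname{Dist}(E_1,E_2)=1$. For matrices, $\operatorname{Dist}(G,H)$ means $\operatorname{Dist}(\operatorname{range}(G),\operatorname{range}(H))$.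
   Formalization: The strict inequality fails when σ_{r+1}(M)=0 or Dist(A,U^(r))=0, since the right-hand side is then 0 (e.g. M=diag(1,0), r=1, A=e_1 gives 0<0); what is proved is ≤ in general and strict < when both quantities are positive. *)

(* Defs.v *)
From mathcomp Require Export all_boot all_order all_algebra.
From mathcomp Require Export boolp classical_sets reals.
From mathcomp Require Export polyrcf.

Set Implicit Arguments.
Unset Strict Implicit.
Unset Printing Implicit Defensive.

Import Order.TTheory GRing.Theory Num.Theory.
Local Open Scope classical_set_scope.
Local Open Scope ring_scope.

Definition l2norm (R : realType) (k : nat) (x : 'cV[R]_k) : R :=
  Num.sqrt (\sum_(i < k) x i 0 ^+ 2).

Definition spectral_norm (R : realType) (p q : nat) (W : 'M[R]_(p, q)) : R :=
  sup [set l2norm (W *m x) | x in [set x : 'cV[R]_q | l2norm x <= 1]].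

Definition orthonormal_cols (R : realType) (p q : nat) (W : 'M[R]_(p, q)) :
    Prop :=
  W^T *m W = 1%:M.

(* The real eigenvalues of S in nonincreasing order, each repeated according to
   its algebraic multiplicity; all the eigenvalues when S is symmetric. *)
Definition eigenvalues_desc (R : realType) (k : nat) (S : 'M[R]_k) : seq R :=
  let p := char_poly S in
  sort >=%R (flatten [seq nseq (mup x p) x | x <- rootsR p]).

(* Indexed from 1: [singular_value j M] is the j-th largest singular value, the
   square root of the j-th largest eigenvalue of M^T M. *)
Definition singular_value (R : realType) (m n : nat) (j : nat)
    (M : 'M[R]_(m, n)) : R :=
  Num.sqrt (nth 0 (eigenvalues_desc (M^T *m M)) j.-1).

(* Full SVD split after the r-th singular value (meant for r <= minn m n).
   [row_mx U Up] and [row_mx V Vp] are m x m and n x n orthogonal matrices, and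
   Sp is rectangular with sigma_(r+1), sigma_(r+2), ... on its diagonal. *)
Definition is_split_svd (R : realType) (m n r : nat) (M : 'M[R]_(m, n))
    (U : 'M[R]_(m, r)) (S : 'M[R]_r) (V : 'M[R]_(n, r))
    (Up : 'M[R]_(m, m - r)) (Sp : 'M[R]_(m - r, n - r))
    (Vp : 'M[R]_(n, n - r)) : Prop :=
  [/\ orthonormal_cols (row_mx U Up),
      orthonormal_cols (row_mx V Vp),
      S = diag_mx (\row_(i < r) singular_value i.+1 M),
      Sp = \matrix_(i, j) (singular_value (r + i).+1 M *+ (i == j :> nat)) &
      M = U *m S *m V^T + Up *m Sp *m Vp^T].

(* The Penrose conditions. MathComp's [pinvmx] is a one-sided generalized
   inverse, in general different from the Moore-Penrose one. *)
Definition is_moore_penrose (R : realType) (p q : nat)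
    (W : 'M[R]_(p, q)) (X : 'M[R]_(q, p)) : Prop :=
  [/\ W *m X *m W = W,
      X *m W *m X = X,
      (W *m X)^T = W *m X &
      (X *m W)^T = X *m W].

Definition moore_penrose (R : realType) (p q : nat) (W : 'M[R]_(p, q)) :
    'M[R]_(q, p) :=
  xget 0 [set X | is_moore_penrose W X].

Lemma is_moore_penrose_uniq (R : realType) (p q : nat) (W : 'M[R]_(p, q))
    (X Y : 'M[R]_(q, p)) :
  is_moore_penrose W X -> is_moore_penrose W Y -> X = Y.
Proof.
move=> [wxw xwx wxT xwT] [wyw ywy wyT ywT].
have hwx : W *m X = W *m Y.
  rewrite -[in LHS]wyw -mulmxA -wxT -wyT -trmx_mul.
  by rewrite mulmxA wxw.
have hxw : X *m W = Y *m W.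
  rewrite -[in LHS]wyw !mulmxA -(mulmxA (X *m W)) -xwT -ywT -trmx_mul.
  by rewrite -!mulmxA (mulmxA W) wxw.
by rewrite -xwx hxw -mulmxA hwx mulmxA ywy.
Qed.

Lemma moore_penroseE (R : realType) (p q : nat) (W : 'M[R]_(p, q))
    (X : 'M[R]_(q, p)) :
  is_moore_penrose W X -> moore_penrose W = X.
Proof.
move=> hX; apply: (@is_moore_penrose_uniq _ _ _ W) => //.
by rewrite /moore_penrose; case: xgetP => [Y _ //|/(_ X)].
Qed.

Lemma moore_penrose_orthonormal (R : realType) (p q : nat)
    (W : 'M[R]_(p, q)) :
  orthonormal_cols W -> moore_penrose W = W^T.
Proof.
move=> hW; apply: moore_penroseE; rewrite /orthonormal_cols in hW.
by split; rewrite ?trmx_mul ?trmxK // ?hW ?mul1mx // -mulmxA hW mulmx1.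
Qed.

Definition range_mx (R : realType) (k q : nat) (W : 'M[R]_(k, q)) :
    {vspace 'cV[R]_k} :=
  limg (linfun (mulmx W : 'cV[R]_q -> 'cV[R]_k)).

Lemma mem_range_mx (R : realType) (k q : nat) (W : 'M[R]_(k, q))
    (v : 'cV[R]_k) :
  v \in range_mx W <-> exists x : 'cV[R]_q, v = W *m x.
Proof.
split=> [/memv_imgP[x _ ->]|[x ->]]; first by exists x; rewrite lfunE.
by apply/memv_imgP; exists x; rewrite ?memvf // lfunE.
Qed.

Definition is_orthonormal_basis (R : realType) (k q : nat)
    (E : {vspace 'cV[R]_k}) (G : 'M[R]_(k, q)) : Prop :=
  orthonormal_cols G /\ range_mx G = E.

Definition is_orthonormal_basis_perp (R : realType) (k q : nat)
    (E : {vspace 'cV[R]_k}) (G : 'M[R]_(k, q)) : Prop :=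
  orthonormal_cols G /\
  forall v : 'cV[R]_k,
    v \in range_mx G <-> (forall u, u \in E -> u^T *m v = 0).

(* ||Gp^T H|| does not depend on the choice of Gp and H, so the set below is a
   singleton and [xget] returns its element. *)
Definition subspace_dist (R : realType) (k : nat) (E1 E2 : {vspace 'cV[R]_k}) :
    R :=
  if \dim E1 == \dim E2 then
    xget 0 [set d | exists (p q : nat) (Gp : 'M[R]_(k, p)) (H : 'M[R]_(k, q)),
      [/\ is_orthonormal_basis_perp E1 Gp,
          is_orthonormal_basis E2 H &
          d = spectral_norm (Gp^T *m H)]]
  else 1.

Definition mx_dist (R : realType) (k p q : nat) (G : 'M[R]_(k, p))
    (H : 'M[R]_(k, q)) : R :=
  subspace_dist (range_mx G) (range_mx H).

(* Main.v *)
Require Import Defs.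
From mathcomp Require Import ring lra.

Set Implicit Arguments.
Unset Strict Implicit.
Unset Printing Implicit Defensive.

Import Order.TTheory GRing.Theory Num.Theory.
Local Open Scope ring_scope.

(** Write C = U^T A, D = Up^T A and d = Dist(A, U): C and D are the cosine and
    sine blocks of the frame A with respect to the singular basis. As A has
    orthonormal columns, A^+ = A^T, so the decomposition of M gives

      B^T = M^T A = V S C + Vp Sp^T D.

    The hypothesis gives d < 1, so C is invertible, with |C^-1| at most
    1 / sqrt (1 - d^2) ([cross_gram_inv_bound]), and |D| is at most d
    ([sin_bound]). Since S C is invertible, B^T has the same range as

      V + Vp E,   where E = Sp^T D C^-1 S^-1,

    so that the range of B^T is the graph of E over the range of V. The singular
    values satisfy |Sp^T| <= sigma_(r+1) and |S^-1| <= 1 / sigma_r, whence |E| is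
    at most q = c d: this is a bound on the tangent of the largest angle between
    the range of B^T and that of V. The distance is the sine of that angle, hence
    at most q / sqrt (1 + q^2) ([mx_dist_graph]), which is at most q, and less
    than q as soon as q > 0.

    Everything is phrased with bounds |W x| <= a |x| ([op_bound]), which compose
    and pass to the transpose; the spectral norm occurs only where distances are
    unfolded. *)

(** * The Euclidean norm *)

Lemma l2norm_ge0 (R : realType) k (x : 'cV[R]_k) : 0 <= l2norm x.
Proof. exact: sqrtr_ge0. Qed.

Lemma l2norm_sqr (R : realType) k (x : 'cV[R]_k) :
  l2norm x ^+ 2 = (x^T *m x) 0 0.
Proof.
rewrite sqr_sqrtr ?mxE; last by apply: sumr_ge0 => i _; apply: sqr_ge0.
by apply: eq_bigr => i _; rewrite mxE.
Qed.

Lemma l2norm_sqrD (R : realType) k (x y : 'cV[R]_k) :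
  l2norm (x + y) ^+ 2 =
  l2norm x ^+ 2 + (x^T *m y) 0 0 *+ 2 + l2norm y ^+ 2.
Proof.
have yxE : (y^T *m x) 0 0 = (x^T *m y) 0 0.
  by rewrite -[x in LHS]trmxK -trmx_mul mxE.
have addE (a b : 'M[R]_1) : (a + b) 0 0 = a 0 0 + b 0 0 by rewrite mxE.
have trD : (x + y)^T = x^T + y^T by rewrite linearD.
by rewrite !l2norm_sqr trD mulmxDl !mulmxDr !addE yxE mulr2n; ring.
Qed.

Lemma l2norm0 (R : realType) k : l2norm (0 : 'cV[R]_k) = 0.
Proof. by apply/eqP; rewrite -sqrf_eq0 l2norm_sqr mulmx0 mxE. Qed.

Lemma l2norm_eq0 (R : realType) k (x : 'cV[R]_k) : l2norm x = 0 -> x = 0.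
Proof.
move/eqP; rewrite sqrtr_eq0 => x_le0.
apply/matrixP => i j; rewrite ord1 mxE; apply/eqP; rewrite -sqrf_eq0.
have x2_ge0 (l : 'I_k) : true -> 0 <= x l 0 ^+ 2 by rewrite sqr_ge0.
have /eqP : \sum_(l < k) x l 0 ^+ 2 = 0.
  by apply/eqP; rewrite eq_le x_le0 sumr_ge0.
by rewrite psumr_eq0 // => /allP /(_ i); rewrite mem_index_enum => /(_ isT).
Qed.

Lemma l2normZ (R : realType) k (a : R) (x : 'cV[R]_k) :
  l2norm (a *: x) = `|a| * l2norm x.
Proof.
rewrite -sqrtr_sqr -sqrtrM ?sqr_ge0 //; congr Num.sqrt.
by rewrite mulr_sumr; apply: eq_bigr => i _; rewrite mxE exprMn.
Qed.

Lemma l2norm_le (R : realType) k l (x : 'cV[R]_k) (y : 'cV[R]_l) :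
  (l2norm x <= l2norm y) = (l2norm x ^+ 2 <= l2norm y ^+ 2).
Proof. by rewrite ler_sqr // nnegrE l2norm_ge0. Qed.

Lemma l2norm_orthonormal (R : realType) k q (W : 'M[R]_(k, q)) (x : 'cV_q) :
  orthonormal_cols W -> l2norm (W *m x) = l2norm x.
Proof.
move=> W1; apply/eqP; rewrite -(@eqrXn2 _ 2) ?nnegrE ?l2norm_ge0 // !l2norm_sqr.
by rewrite trmx_mul mulmxA -(mulmxA x^T) W1 mulmx1.
Qed.

(** Pythagoras for the orthogonal projection [W *m W^T] onto the range of
    [W]. *)
Lemma l2norm_sqr_proj (R : realType) k q (W : 'M[R]_(k, q)) (z : 'cV_k) :
  orthonormal_cols W ->
  l2norm z ^+ 2 = l2norm (W^T *m z) ^+ 2 + l2norm (z - W *m (W^T *m z)) ^+ 2.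
Proof.
move=> W1; set y := W^T *m z.
rewrite -{1}[z](subrK (W *m y)) (l2norm_sqrD (z - _)) (l2norm_orthonormal _ W1).
have Ww : W^T *m (z - W *m y) = 0 by rewrite mulmxBr mulmxA W1 mul1mx subrr.
have -> : (z - W *m y)^T *m (W *m y) = (W^T *m (z - W *m y))^T *m y.
  by rewrite trmx_mul trmxK mulmxA.
rewrite Ww trmx0 mul0mx.
by rewrite mxE mul0rn addr0 addrC.
Qed.

Lemma bessel (R : realType) k q (W : 'M[R]_(k, q)) (z : 'cV_k) :
  orthonormal_cols W -> l2norm (W^T *m z) <= l2norm z.
Proof.
by move=> W1; rewrite l2norm_le (l2norm_sqr_proj z W1) lerDl sqr_ge0.
Qed.

(** * Operator bounds *)

Definition op_bound (R : realType) p q (a : R) (W : 'M[R]_(p, q)) : Prop :=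
  forall x : 'cV_q, l2norm (W *m x) <= a * l2norm x.

Lemma op_boundM (R : realType) p q l (a b : R) (W : 'M[R]_(p, q))
    (X : 'M[R]_(q, l)) :
  0 <= a -> op_bound a W -> op_bound b X -> op_bound (a * b) (W *m X).
Proof.
move=> a0 Wa Xb x; rewrite -mulmxA (le_trans (Wa _)) // -mulrA.
exact: ler_wpM2l.
Qed.

(** Let u = W^T z, so that (W u)^T z = |u|^2. Expanding
    0 <= |W u - a^2 z|^2 and bounding |W u|^2 by a^2 |u|^2 leaves
    a^2 |u|^2 <= a^4 |z|^2, which can be divided by a^2 unless a = 0. *)
Lemma op_bound_tr (R : realType) p q (a : R) (W : 'M[R]_(p, q)) :
  0 <= a -> op_bound a W -> op_bound a W^T.
Proof.
move=> a0 Wa z; set u := W^T *m z.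
rewrite -ler_sqr ?nnegrE ?mulr_ge0 ?l2norm_ge0 //.
have Wu : l2norm (W *m u) ^+ 2 <= a ^+ 2 * l2norm u ^+ 2.
  by rewrite -exprMn ler_sqr ?nnegrE ?mulr_ge0 ?l2norm_ge0.
have Wuz : ((W *m u)^T *m z) 0 0 = l2norm u ^+ 2.
  by rewrite l2norm_sqr trmx_mul -mulmxA.
have := sqr_ge0 (l2norm (W *m u + (- a ^+ 2) *: z)).
rewrite l2norm_sqrD -scalemxAr mxE Wuz l2normZ exprMn.
rewrite real_normK ?num_real // exprMn.
have [a_eq0|a_neq0] := eqVneq a 0.
  have /l2norm_eq0 Wu0 : l2norm (W *m u) = 0.
    by apply/eqP; rewrite eq_le l2norm_ge0 andbT (le_trans (Wa _)) // a_eq0 mul0r.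
  by rewrite -Wuz Wu0 trmx0 mul0mx mxE mulr_ge0 ?sqr_ge0.
have a2_gt0 : 0 < a ^+ 2 by rewrite exprn_even_gt0.
rewrite -(ler_pM2l a2_gt0) => ?; nra.
Qed.

(** Without this the supremum in [spectral_norm] would take its default
    value. *)
Lemma unit_ball_image_ub (R : realType) p q (a : R) (W : 'M[R]_(p, q)) :
  0 <= a -> op_bound a W ->
  has_ubound [set l2norm (W *m x) | x in [set x : 'cV_q | l2norm x <= 1]]%classic.
Proof.
move=> a0 Wa; exists a => _ [y /= y1 <-]; apply: le_trans (Wa y) _.
by rewrite -[leRHS]mulr1 ler_wpM2l.
Qed.

Lemma spectral_norm_le (R : realType) p q (a : R) (W : 'M[R]_(p, q)) :
  0 <= a -> op_bound a W -> spectral_norm W <= a.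
Proof.
move=> a0 Wa; apply: ge_sup.
  by exists (l2norm (W *m 0)); exists 0 => //=; rewrite l2norm0.
move=> _ [x /= x1 <-]; apply: le_trans (Wa x) _.
by rewrite -[leRHS]mulr1 ler_wpM2l.
Qed.

Lemma spectral_norm_bound (R : realType) p q (a : R) (W : 'M[R]_(p, q)) :
  0 <= a -> op_bound a W -> op_bound (spectral_norm W) W.
Proof.
move=> a0 Wa x; have [x0|x_neq0] := eqVneq (l2norm x) 0.
  by rewrite (l2norm_eq0 x0) mulmx0 !l2norm0 mulr0.
have x_gt0 : 0 < l2norm x by rewrite lt_def x_neq0 l2norm_ge0.
rewrite -ler_pdivrMr // mulrC.
have -> : (l2norm x)^-1 * l2norm (W *m x) = l2norm (W *m ((l2norm x)^-1 *: x)).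
  by rewrite -scalemxAr l2normZ ger0_norm // invr_ge0 ltW.
apply: (ub_le_sup (unit_ball_image_ub a0 Wa)).
exists ((l2norm x)^-1 *: x) => //=.
by rewrite l2normZ ger0_norm ?invr_ge0 ?l2norm_ge0 // mulVf.
Qed.

Lemma spectral_norm_ge0 (R : realType) p q (a : R) (W : 'M[R]_(p, q)) :
  0 <= a -> op_bound a W -> 0 <= spectral_norm W.
Proof.
move=> a0 Wa; apply: (ub_le_sup (unit_ball_image_ub a0 Wa)).
by exists 0; rewrite /= ?mulmx0 l2norm0.
Qed.

Lemma op_bound_tr_mul_orthonormal (R : realType) k p q (W : 'M[R]_(k, p))
    (H : 'M[R]_(k, q)) :
  orthonormal_cols W -> orthonormal_cols H -> op_bound 1 (W^T *m H).
Proof.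
move=> W1 H1 x; rewrite mul1r -mulmxA (le_trans (bessel _ W1)) //.
by rewrite l2norm_orthonormal.
Qed.

(** * Orthonormal families *)

Lemma orthonormal_row_mx (R : realType) k p q (G : 'M[R]_(k, p))
    (W : 'M[R]_(k, q)) :
  orthonormal_cols (row_mx G W) <->
  [/\ orthonormal_cols G, orthonormal_cols W & G^T *m W = 0].
Proof.
rewrite /orthonormal_cols tr_row_mx mul_col_row scalar_mx_block; split.
  by case/eq_block_mx.
case=> -> -> GW; rewrite GW -[W^T *m G]trmxK trmx_mul trmxK GW.
by rewrite trmx0.
Qed.

(** The bound that makes the maximal orthonormal extension of
    [orthonormal_basis_perp_ex] exist. *)
Lemma orthonormal_cols_leq (R : realType) k q (W : 'M[R]_(k, q)) :
  orthonormal_cols W -> (q <= k)%N.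
Proof.
by move=> W1; rewrite -[q in (q <= _)%N](mxrank1 R) -W1 mulmx_max_rank.
Qed.

Lemma perp_range_mx (R : realType) k q (W : 'M[R]_(k, q)) (v : 'cV_k) :
  (forall u, u \in range_mx W -> u^T *m v = 0) <-> W^T *m v = 0.
Proof.
split=> [Wv|Wv _ /mem_range_mx[x ->]]; last first.
  by rewrite trmx_mul -mulmxA Wv mulmx0.
apply/l2norm_eq0/eqP; rewrite -sqrf_eq0 l2norm_sqr mulmxA -trmx_mul.
by rewrite Wv ?mxE //; apply/mem_range_mx; exists (W^T *m v).
Qed.

Lemma basis_perp_mul0 (R : realType) k p q (G : 'M[R]_(k, q))
    (W : 'M[R]_(k, p)) :
  is_orthonormal_basis_perp (range_mx G) W -> W^T *m G = 0.
Proof.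
case=> _ Wperp; apply: trmx_inj; rewrite trmx_mul trmxK trmx0.
apply/matrixP => i j; have : G^T *m (W *m delta_mx j 0) = 0 :> 'cV_q.
  by apply/perp_range_mx/Wperp/mem_range_mx; exists (delta_mx j 0).
by rewrite mulmxA -colE => /matrixP/(_ i 0); rewrite !mxE.
Qed.

(** [subspace_dist] is chosen from a set that contains a value only if the
    orthogonal complement has an orthonormal basis. To get one, extend [G] by
    as many orthonormal columns [W] as possible. If some v orthogonal to [G] were
    outside the range of [W], its normalized residual v - W W^T v could be
    appended to [W]. *)
Lemma orthonormal_basis_perp_ex (R : realType) k q (G : 'M[R]_(k, q)) :
  orthonormal_cols G ->
  exists p (W : 'M[R]_(k, p)), is_orthonormal_basis_perp (range_mx G) W.
Proof.
move=> G1.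
pose ext p := `[< exists W : 'M[R]_(k, p), orthonormal_cols (row_mx G W) >].
have ext0 : exists p, ext p.
  exists 0%N; apply/asboolP; exists 0; apply/orthonormal_row_mx; split=> //.
    by apply/matrixP => - [].
  by rewrite mulmx0.
have ext_le p : ext p -> (p <= k)%N.
  by move=> /asboolP[W /orthonormal_row_mx[_ /orthonormal_cols_leq]].
case: (ex_maxnP ext0 ext_le) => p /asboolP[W GW1] p_max.
have /orthonormal_row_mx[_ W1 GW] := GW1.
exists p, W; split=> // v; rewrite perp_range_mx mem_range_mx; split.
  by case=> x ->; rewrite mulmxA GW mul0mx.
move=> Gv; exists (W^T *m v); apply/eqP; rewrite -subr_eq0; apply/negPn/negP.
set w := v - _ => w_neq0.
have Gw : G^T *m w = 0 by rewrite mulmxBr Gv (mulmxA G^T) GW mul0mx subrr.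
have Ww : W^T *m w = 0 by rewrite mulmxBr (mulmxA W^T W) W1 mul1mx subrr.
pose e := (l2norm w)^-1 *: w.
suff : (p + 1 <= p)%N by rewrite addn1 ltnn.
apply: p_max; apply/asboolP; exists (row_mx W e).
apply/orthonormal_row_mx; split=> //; last first.
  by rewrite mul_mx_row GW -scalemxAr Gw scaler0 row_mx0.
apply/orthonormal_row_mx; split=> //; last by rewrite -scalemxAr Ww scaler0.
apply/matrixP => i j; rewrite !ord1 -l2norm_sqr l2normZ mxE eqxx.
rewrite ger0_norm ?invr_ge0 ?l2norm_ge0 // mulVf ?expr1n //.
by apply: contraNneq w_neq0 => /l2norm_eq0 ->.
Qed.

Lemma range_mx_mul_unit (R : realType) k q (W : 'M[R]_(k, q)) (X : 'M[R]_q) :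
  X \in unitmx -> range_mx (W *m X) = range_mx W.
Proof.
move=> X_unit; apply/vspaceP => v; apply/idP/idP => /mem_range_mx[x ->].
  by apply/mem_range_mx; exists (X *m x); rewrite mulmxA.
apply/mem_range_mx; exists (invmx X *m x).
by rewrite -mulmxA (mulmxA X) mulmxV // mul1mx.
Qed.

Lemma dim_range_mx (R : realType) k q (W : 'M[R]_(k, q)) (X : 'M[R]_(q, k)) :
  X *m W = 1%:M -> \dim (range_mx W) = \dim {: 'cV[R]_q}.
Proof.
move=> XW; apply: limg_dim_eq; apply/eqP; rewrite capfv; apply/lker0P => x y.
by rewrite !lfunE /= => /(congr1 (mulmx X)); rewrite !mulmxA XW !mul1mx.
Qed.

(** * Distances between subspaces *)

(** What is used of Dist(G, U) on the hypothesis side: U x is at distance at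
    most Dist(G, U) |x| from the range of [G]. Indeed the residual w of its
    projection lies in the orthogonal complement, w = W t with [W] the chosen
    basis, and t = W^T U x. When the dimensions differ the distance is 1 and
    the bound is trivial. *)
Lemma mx_dist_residual (R : realType) k p q (G : 'M[R]_(k, p))
    (U : 'M[R]_(k, q)) (x : 'cV_q) :
  orthonormal_cols G -> orthonormal_cols U ->
  l2norm (U *m x - G *m (G^T *m (U *m x))) <= mx_dist G U * l2norm x.
Proof.
move=> G1 U1; rewrite /mx_dist /subspace_dist; case: ifP => [_|_]; last first.
  rewrite mul1r -(l2norm_orthonormal x U1) l2norm_le.
  by rewrite (l2norm_sqr_proj (U *m x) G1) lerDr sqr_ge0.
case: xgetP => [d _ [p' [q' [W [H [[W1 Wperp] [H1 HU] ->]]]]]|]; last first.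
  have [p' [W Wbasis]] := orthonormal_basis_perp_ex G1.
  by move=> /(_ (spectral_norm (W^T *m U))) []; exists p', q, W, U.
have /mem_range_mx[y Uxy] : U *m x \in range_mx H.
  by rewrite HU; apply/mem_range_mx; exists x.
set w := _ - _.
have Gw : G^T *m w = 0 by rewrite mulmxBr (mulmxA G^T G) G1 mul1mx subrr.
have /mem_range_mx[t wt] : w \in range_mx W by apply/Wperp/perp_range_mx.
have WG : W^T *m G = 0 by apply: basis_perp_mul0; split.
have tE : t = (W^T *m H) *m y.
  rewrite -mulmxA -Uxy -[U *m x](subrK (G *m (G^T *m (U *m x)))) -/w mulmxDr.
  by rewrite mulmxA WG mul0mx addr0 wt mulmxA W1 mul1mx.
rewrite wt l2norm_orthonormal // tE -(l2norm_orthonormal x U1) Uxy.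
rewrite (l2norm_orthonormal _ H1); apply: (@spectral_norm_bound _ _ _ 1) => //.
exact: op_bound_tr_mul_orthonormal.
Qed.

Lemma mx_dist_ge0 (R : realType) k p q (G : 'M[R]_(k, p)) (H : 'M[R]_(k, q)) :
  0 <= mx_dist G H.
Proof.
rewrite /mx_dist /subspace_dist; case: ifP => // _.
case: xgetP => // d _ [p' [q' [W [K [[W1 _] [K1 _] ->]]]]].
apply: (@spectral_norm_ge0 _ _ _ 1) => //.
exact: op_bound_tr_mul_orthonormal.
Qed.

(** Pythagoras: |A^T U x|^2 is |x|^2 minus the squared residual of the
    projection of U x onto the range of [A]. *)
Lemma cos_bound (R : realType) k p q (A : 'M[R]_(k, p)) (U : 'M[R]_(k, q))
    (x : 'cV_q) :
  orthonormal_cols A -> orthonormal_cols U -> mx_dist A U <= 1 ->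
  Num.sqrt (1 - mx_dist A U ^+ 2) * l2norm x <= l2norm (A^T *m U *m x).
Proof.
move=> A1 U1 d_le1; have d_ge0 := mx_dist_ge0 A U.
have := mx_dist_residual x A1 U1.
have := l2norm_sqr_proj (U *m x) A1.
rewrite (l2norm_orthonormal x U1) -mulmxA; set d := mx_dist A U.
set res := l2norm (_ - _) => x2E res_le.
have res2_le : res ^+ 2 <= d ^+ 2 * l2norm x ^+ 2.
  by rewrite -exprMn ler_sqr ?nnegrE ?mulr_ge0 ?l2norm_ge0.
rewrite -ler_sqr ?nnegrE ?mulr_ge0 ?l2norm_ge0 ?sqrtr_ge0 //.
rewrite exprMn sqr_sqrtr ?subr_ge0 ?expr_le1 //; lra.
Qed.

(** Stated for the transpose because [kermx] is a left kernel and
    [cos_bound] bounds [C^T] from below. *)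
Lemma unitmx_tr_inj (R : realType) k (C : 'M[R]_k) :
  (forall x : 'cV_k, C^T *m x = 0 -> x = 0) -> C \in unitmx.
Proof.
move=> C_inj; rewrite -row_free_unit -kermx_eq0; apply/eqP/trmx_inj/matrixP.
move=> i j; have : C^T *m ((kermx C)^T *m delta_mx j 0) = 0 :> 'cV_k.
  by rewrite mulmxA -trmx_mul mulmx_ker trmx0 mul0mx.
by move/C_inj; rewrite -colE => /matrixP/(_ i 0); rewrite !mxE.
Qed.

Lemma cross_gram_unit (R : realType) k q (A U : 'M[R]_(k, q)) :
  orthonormal_cols A -> orthonormal_cols U -> mx_dist A U < 1 ->
  U^T *m A \in unitmx.
Proof.
move=> A1 U1 d_lt1; apply: unitmx_tr_inj => x.
rewrite trmx_mul trmxK => Cx; have := cos_bound x A1 U1 (ltW d_lt1).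
rewrite Cx l2norm0 pmulr_rle0 ?sqrtr_gt0 ?subr_gt0 ?expr_lt1 ?mx_dist_ge0 //.
by move=> x_le0; apply: l2norm_eq0; apply/eqP; rewrite eq_le x_le0 l2norm_ge0.
Qed.

(** [cos_bound] bounds the inverse of A^T U, the transpose of U^T A; the bound
    is carried over by [op_bound_tr]. *)
Lemma cross_gram_inv_bound (R : realType) k q (A U : 'M[R]_(k, q)) :
  orthonormal_cols A -> orthonormal_cols U -> mx_dist A U < 1 ->
  op_bound (Num.sqrt (1 - mx_dist A U ^+ 2))^-1 (invmx (U^T *m A)).
Proof.
move=> A1 U1 d_lt1; have C_unit := cross_gram_unit A1 U1 d_lt1.
rewrite -[invmx _]trmxK; apply: op_bound_tr; first by rewrite invr_ge0 sqrtr_ge0.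
move=> z; have := cos_bound ((invmx (U^T *m A))^T *m z) A1 U1 (ltW d_lt1).
have -> : A^T *m U = (U^T *m A)^T by rewrite trmx_mul trmxK.
rewrite (mulmxA (U^T *m A)^T) -trmx_mul mulVmx // trmx1 mul1mx.
by rewrite -ler_pdivlMl // sqrtr_gt0 subr_gt0 expr_lt1 // mx_dist_ge0.
Qed.

(** Bessel's inequality in the basis formed by [U] and [Up] gives
    |U^T A x|^2 + |Up^T A x|^2 <= |x|^2, and the first term is at least
    (1 - d^2) |x|^2. *)
Lemma sin_bound (R : realType) k q l (A U : 'M[R]_(k, q)) (Up : 'M[R]_(k, l)) :
  orthonormal_cols A -> orthonormal_cols (row_mx U Up) -> mx_dist A U < 1 ->
  op_bound (mx_dist A U) (Up^T *m A).
Proof.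
move=> A1 UUp1 d_lt1 x; have [U1 _ _] := (orthonormal_row_mx _ _).1 UUp1.
have d_ge0 := mx_dist_ge0 A U.
have C_unit := cross_gram_unit A1 U1 d_lt1.
have := cross_gram_inv_bound A1 U1 d_lt1 (U^T *m A *m x).
rewrite (mulmxA (invmx _)) mulVmx // mul1mx ler_pdivlMl; last first.
  by rewrite sqrtr_gt0 subr_gt0 expr_lt1.
rewrite -ler_sqr ?nnegrE ?mulr_ge0 ?l2norm_ge0 ?sqrtr_ge0 //.
rewrite exprMn sqr_sqrtr ?subr_ge0 ?expr_le1 ?(ltW d_lt1) // => cos_le.
rewrite -ler_sqr ?nnegrE ?mulr_ge0 ?l2norm_ge0 // exprMn.
have := bessel (A *m x) UUp1.
rewrite l2norm_le (l2norm_orthonormal x A1) tr_row_mx mul_col_mx !mulmxA.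
have -> : l2norm (col_mx (U^T *m A *m x) (Up^T *m A *m x)) ^+ 2 =
          l2norm (U^T *m A *m x) ^+ 2 + l2norm (Up^T *m A *m x) ^+ 2.
  by rewrite !l2norm_sqr tr_col_mx mul_row_col mxE.
lra.
Qed.

(** From tangent to sine. Let [F] = V + Vp E and s = 1 / (1 + a^2). A vector
    V w is within a / sqrt (1 + a^2) |w| of the range of [F], because
    V w - F (s w) = (1 - s) V w - s Vp E w is an orthogonal sum whose squared norm
    is at most ((1 - s)^2 + s^2 a^2) |w|^2 = a^2 / (1 + a^2) |w|^2; the value of s
    minimizes this bound. Projecting V w onto the orthogonal complement of the
    range of [F] does not see F (s w). *)
Lemma mx_dist_graph (R : realType) k p q (V : 'M[R]_(k, p)) (Vp : 'M[R]_(k, q))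
    (E : 'M[R]_(q, p)) (a : R) :
  orthonormal_cols (row_mx V Vp) -> 0 <= a -> op_bound a E ->
  mx_dist (V + Vp *m E) V <= a / Num.sqrt (1 + a ^+ 2).
Proof.
move=> /orthonormal_row_mx[V1 Vp1 VVp] a0 Ea.
have VF : V^T *m (V + Vp *m E) = 1%:M.
  by rewrite mulmxDr V1 mulmxA VVp mul0mx addr0.
have a2_gt0 : 0 < 1 + a ^+ 2 by rewrite ltr_pwDl ?sqr_ge0.
have b_ge0 : 0 <= a / Num.sqrt (1 + a ^+ 2) by rewrite divr_ge0 ?sqrtr_ge0.
rewrite /mx_dist /subspace_dist (dim_range_mx VF) (dim_range_mx V1) eqxx.
case: xgetP => [d _ [p' [q' [W [H [Wperp [H1 HV] ->]]]]]|_] //.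
have WF := basis_perp_mul0 Wperp; have [W1 _] := Wperp.
apply: spectral_norm_le => // x; rewrite -mulmxA.
have /mem_range_mx[w Hxw] : H *m x \in range_mx V.
  by rewrite -HV; apply/mem_range_mx; exists x.
have -> : l2norm x = l2norm w.
  by rewrite -(l2norm_orthonormal x H1) Hxw l2norm_orthonormal.
pose s := (1 + a ^+ 2)^-1; set F := V + Vp *m E in WF.
have HxE : H *m x - F *m (s *: w) = V *m ((1 - s) *: w) + Vp *m (- s *: (E *m w)).
  rewrite Hxw -!scalemxAr /F mulmxDl scalerDr scalerBl scale1r scaleNr mulmxA.
  by rewrite opprD addrA.
have -> : W^T *m (H *m x) = W^T *m (H *m x - F *m (s *: w)).
  by rewrite mulmxBr (mulmxA _ F) WF mul0mx subr0.
apply: le_trans (bessel _ W1) _; rewrite HxE.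
rewrite -ler_sqr ?nnegrE ?l2norm_ge0 ?(mulr_ge0 b_ge0) ?l2norm_ge0 //.
rewrite l2norm_sqrD.
have -> : (V *m ((1 - s) *: w))^T *m (Vp *m (- s *: (E *m w))) = 0.
  by rewrite trmx_mul -mulmxA (mulmxA V^T) VVp mul0mx mulmx0.
have -> : (a / Num.sqrt (1 + a ^+ 2) * l2norm w) ^+ 2 =
    (1 - s) ^+ 2 * l2norm w ^+ 2 + s ^+ 2 * (a ^+ 2 * l2norm w ^+ 2).
  rewrite exprMn expr_div_n (sqr_sqrtr (ltW a2_gt0)) /s.
  by field; rewrite gt_eqF.
have Ew2 : l2norm (E *m w) ^+ 2 <= a ^+ 2 * l2norm w ^+ 2.
  by rewrite -exprMn ler_sqr ?nnegrE ?mulr_ge0 ?l2norm_ge0.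
rewrite mxE mul0rn addr0 !l2norm_orthonormal // !l2normZ !exprMn.
rewrite !real_normK ?num_real // sqrrN.
by rewrite lerD2l ler_wpM2l ?sqr_ge0.
Qed.

(** * Singular values *)

Lemma singular_value_ge0 (R : realType) m n j (M : 'M[R]_(m, n)) :
  0 <= singular_value j M.
Proof. exact: sqrtr_ge0. Qed.

(** Beyond the end of the list of eigenvalues the default 0 is at most any
    square root. *)
Lemma singular_value_anti (R : realType) m n i j (M : 'M[R]_(m, n)) :
  (i <= j)%N -> singular_value j M <= singular_value i M.
Proof.
move=> leij; rewrite /singular_value; set s := eigenvalues_desc _.
have [js|sj] := ltnP j.-1 (size s); last by rewrite nth_default ?sqrtr0 ?sqrtr_ge0.
have ijp : (i.-1 <= j.-1)%N by rewrite -!subn1 leq_sub2r.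
apply: ler_wsqrtr; apply: (sorted_leq_nth ge_trans ge_refl) => //.
- by apply: sort_sorted => x y; exact: le_total.
- by rewrite inE (leq_ltn_trans ijp).
Qed.

Lemma op_bound_rect_diag (R : realType) p q (s : nat -> R) (a : R) :
  (forall i, (i < p)%N -> (i < q)%N -> 0 <= s i <= a) -> 0 <= a ->
  op_bound a (\matrix_(i < p, j < q) (s i *+ (i == j :> nat))).
Proof.
move=> s_le a0 x; set W := \matrix_(i, j) _.
rewrite -ler_sqr ?nnegrE ?mulr_ge0 ?l2norm_ge0 // exprMn.
rewrite !sqr_sqrtr ?sumr_ge0 // => [|i _|i _]; rewrite ?sqr_ge0 //.
have coordE (i : 'I_p) : (W *m x) i 0 ^+ 2 <=
    a ^+ 2 * \sum_(j < q) x j 0 ^+ 2 *+ (i == j :> nat).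
  rewrite mxE; have [iq|qi] := ltnP i q; last first.
    rewrite !big1 ?mulr0 ?expr0n //= => j _; rewrite ?mxE gtn_eqF ?mulr0n ?mul0r //.
      exact: leq_trans (ltn_ord j) qi.
    exact: leq_trans (ltn_ord j) qi.
  have neq (j : 'I_q) : j != Ordinal iq -> (i == j :> nat) = false.
    by apply: contraNF => /eqP ij; apply/eqP/val_inj.
  rewrite (bigD1 (Ordinal iq)) //= big1 => [|j /neq ij]; last first.
    by rewrite mxE ij mul0r.
  rewrite (bigD1 (Ordinal iq)) //= big1 => [|j /neq ij]; last by rewrite ij.
  have /andP[si0 sia] := s_le i (ltn_ord i) iq.
  rewrite mxE !addr0 /= eqxx !mulr1n exprMn ler_wpM2r ?sqr_ge0 //.
  by rewrite ler_sqr ?nnegrE.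
apply: le_trans (ler_sum _ (fun i _ => coordE i)) _.
rewrite -mulr_sumr ler_wpM2l ?sqr_ge0 // exchange_big ler_sum // => j _.
have [jp|pj] := ltnP j p; last first.
  rewrite big1 ?sqr_ge0 // => i _; rewrite ltn_eqF //.
  exact: leq_trans (ltn_ord i) pj.
rewrite (bigD1 (Ordinal jp)) //= eqxx big1 ?addr0 // => i.
by move=> /negPf; rewrite -val_eqE /= => ->.
Qed.

(** * Perturbation of the right singular subspace *)

(* The strict bound is impossible when its right-hand side is 0, that is, when
   sigma_(r+1) = 0 or Dist(A, U) = 0. The conclusion is thus <= in general and
   < outside these degenerate cases. *)
Theorem theorem3p1 (R : realType) (m n r : nat) (M : 'M[R]_(m, n))
    (A U : 'M[R]_(m, r)) (S : 'M[R]_r) (V : 'M[R]_(n, r))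
    (Up : 'M[R]_(m, m - r)) (Sp : 'M[R]_(m - r, n - r))
    (Vp : 'M[R]_(n, n - r))
    (r_gt0 : (0 < r)%N) (r_lt : (r < minn m n)%N)
    (A_orthonormal : orthonormal_cols A)
    (svdM : is_split_svd M U S V Up Sp Vp) :
  let B := moore_penrose A *m M in
  let sr := singular_value r M in
  let sr1 := singular_value r.+1 M in
  let d := mx_dist A U in
  let c := 1 / Num.sqrt (1 - d ^+ 2) * (sr1 / sr) in
  sr1 < sr ->
  d < Num.sqrt (1 - sr1 ^+ 2 / sr ^+ 2) ->
  mx_dist B^T V <= c * d /\
  (0 < sr1 -> 0 < d -> mx_dist B^T V < c * d).
Proof.
move=> B sr sr1 d c sr1_lt d_lt.
case: svdM => UUp1 VVp1 SE SpE ME.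
have [U1 _ _] := (orthonormal_row_mx _ _).1 UUp1.
have sr1_ge0 : 0 <= sr1 by apply: singular_value_ge0.
have sr_gt0 : 0 < sr by apply: le_lt_trans sr1_lt.
have d_ge0 : 0 <= d by apply: mx_dist_ge0.
have d_lt1 : d < 1.
  apply: lt_le_trans d_lt _; rewrite -[leRHS]sqrtr1 ler_wsqrtr //.
  by rewrite gerBl divr_ge0 ?sqr_ge0.
have cos_gt0 : 0 < Num.sqrt (1 - d ^+ 2) by rewrite sqrtr_gt0 subr_gt0 expr_lt1.
pose C := U^T *m A; pose D := Up^T *m A.
have C_unit : C \in unitmx by apply: cross_gram_unit.
pose T : 'M[R]_r :=
  \matrix_(i < r, j < r) ((singular_value i.+1 M)^-1 *+ (i == j :> nat)).
have s_ge i : (i < r)%N -> sr <= singular_value i.+1 M.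
  exact: singular_value_anti.
have TE : T = diag_mx (\row_i (singular_value i.+1 M)^-1).
  by apply/matrixP => i j; rewrite !mxE.
have ST1 : S *m T = 1%:M.
  rewrite SE TE mulmx_diag -diag_const_mx; congr diag_mx.
  apply/rowP => i; rewrite !mxE divff // gt_eqF //.
  by rewrite (lt_le_trans sr_gt0) ?s_ge.
have [S_unit _] := mulmx1_unit ST1.
pose E := Sp^T *m (D *m (invmx C *m T)).
have BE : B^T = (V + Vp *m E) *m (S *m C).
  have tanE : E *m (S *m C) = Sp^T *m D.
    rewrite /E -!mulmxA (mulmxA T) (mulmx1C ST1) mul1mx mulVmx //.
    by rewrite mulmx1.
  have trS : S^T = S by rewrite SE tr_diag_mx.
  rewrite /B moore_penrose_orthonormal // ME trmx_mul trmxK linearD /=.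
  rewrite !trmx_mul !trmxK trS !mulmxDl -(mulmxA Vp) tanE.
  by rewrite /C /D !mulmxA.
have q_ge0 : 0 <= c * d.
  by rewrite /c div1r !mulr_ge0 ?invr_ge0 ?(ltW cos_gt0) ?(ltW sr_gt0).
have Eq : op_bound (c * d) E.
  have -> : c * d = sr1 * (d * ((Num.sqrt (1 - d ^+ 2))^-1 * sr^-1)).
    by rewrite /c; field; rewrite !gt_eqF.
  apply: op_boundM => //.
    apply: op_bound_tr => //; rewrite SpE.
    apply: (op_bound_rect_diag (s := fun i => singular_value (r + i).+1 M)) => //.
    by move=> i _ _; rewrite singular_value_ge0 singular_value_anti // ltnS leq_addr.
  apply: op_boundM => //; first exact: sin_bound.
  apply: op_boundM; rewrite ?invr_ge0 ?(ltW cos_gt0) //.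
    exact: cross_gram_inv_bound.
  apply: (op_bound_rect_diag (s := fun i => (singular_value i.+1 M)^-1)).
    move=> i /s_ge sri _; rewrite invr_ge0 singular_value_ge0 /= lef_pV2 ?posrE //.
    exact: lt_le_trans sri.
  by rewrite invr_ge0 ltW.
have distB : mx_dist B^T V <= c * d / Num.sqrt (1 + (c * d) ^+ 2).
  rewrite BE /mx_dist range_mx_mul_unit; last by rewrite unitmx_mul S_unit.
  exact: mx_dist_graph.
have hyp_gt0 : 0 < 1 + (c * d) ^+ 2 by rewrite ltr_pwDl ?sqr_ge0.
split=> [|sr1_gt0 d_gt0]; first apply: le_trans distB _.
  rewrite ler_pdivrMr ?sqrtr_gt0 // ler_peMr //.
  by rewrite -[leLHS]sqrtr1 ler_wsqrtr // lerDl sqr_ge0.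
have q_gt0 : 0 < c * d by rewrite /c div1r !mulr_gt0 ?invr_gt0.
apply: le_lt_trans distB _.
rewrite ltr_pdivrMr ?sqrtr_gt0 // ltr_pMr //.
by rewrite -[ltLHS]sqrtr1 ltr_sqrt // ltrDl exprn_gt0.
Qed.
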